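(* Let $n\ge3$ and suppose $\lambda$ and $\sigma$ are positive constants satisfying $$\frac{2}{n-2}+\frac{n}{n-2}\frac1\lambda<\sigma\le\lambda.$$ Let $h:(0,1)\to(0,\infty)$ be a continuous function satisfying $\lim_{r\to0^+}h(r)=\infty$. Then there exist $C^\infty$ solutions $u(x)$ and $v(x)$ of the system $$0\le-\Delta u\le v^\lambda,\qquad 0\le-\Delta v\le u^\sigma,\qquad u>1,\ v>1\qquad\text{in }\mathbb{R}^n\setminus\{0\}$$ such that $$u(x)\ne O(h(|x|))\quad\text{as }x\to0\qquad\text{and}\qquad v(x)\ne O(h(|x|))\quad\text{as }x\to0.$$
   Context: The notation $u(x)\ne O(h(|x|))$ as $x\to 0$ means that the statement ''$u(x)=O(h(|x|))$ as $x\to0$'' is false. *)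

(* Defs.v *)
From HB Require Import structures.
From mathcomp Require Import all_boot all_order all_algebra.
From mathcomp Require Import all_classical all_reals all_analysis.
Import Order.TTheory GRing.Theory Num.Theory.
Import numFieldNormedType.Exports.

Set Implicit Arguments.
Unset Strict Implicit.
Unset Printing Implicit Defensive.

Local Open Scope classical_set_scope.
Local Open Scope ring_scope.

(* The library norm `|x| on row vectors is the maximum norm; it induces the same
   topology as the Euclidean norm, but |x| in h(|x|) is the latter. *)
Definition enorm (R : realType) (n : nat) (x : 'rV[R]_n) : R :=
  Num.sqrt (\sum_(i < n) x 0 i ^+ 2).

Definition pderiv (R : realType) (n : nat) (i : 'I_n) (f : 'rV[R]_n -> R) :
  'rV[R]_n -> R := fun x => 'D_(delta_mx 0 i) f x.

Definition pderivs (R : realType) (n : nat) (s : seq 'I_n)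
  (f : 'rV[R]_n -> R) : 'rV[R]_n -> R := foldr (@pderiv R n) f s.

(* Meant for open U: there the iterated partial derivatives at a point of U only
   depend on the restriction of f to U. *)
Definition smooth_on (R : realType) (n : nat) (U : set 'rV[R]_n)
  (f : 'rV[R]_n -> R) : Prop :=
  forall (s : seq 'I_n) (x : 'rV[R]_n), U x ->
    {for x, continuous (pderivs s f)} /\
    (forall i : 'I_n, derivable (pderivs s f) x (delta_mx 0 i)).

Definition laplacian (R : realType) (n : nat) (f : 'rV[R]_n -> R)
  (x : 'rV[R]_n) : R := \sum_(i < n) pderiv i (pderiv i f) x.

(* Main.v *)
Require Import Defs.
From mathcomp Require Import all_boot all_order all_algebra.
From mathcomp Require Import all_classical all_reals all_analysis.
From mathcomp Require Import ring lra.
Import Order.TTheory GRing.Theory Num.Theory.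
Import numFieldNormedType.Exports.
Local Open Scope classical_set_scope.
Local Open Scope ring_scope.

(** The two functions are infinite sums of bubbles concentrated at points p_j
    tending to the origin.  Put kappa = (n-2)/2.  A bubble E(rho, y) is a
    smooth positive superharmonic function of y, of size rho^(-kappa) on the
    ball of radius sqrt(rho) and of size |y|^(-2 kappa) outside.  Take

      u = 2 + sum_j rho_j^alpha E(rho_j, x - p_j),
      v = 2 + sum_j rho_j^beta  E(rho_j, x - p_j),

    with exponents alpha, beta in (0, kappa).  The j-th term of u reaches height
    rho_j^(alpha - kappa) at p_j, which exceeds any prescribed number once rho_j
    is small, while its size away from p_j is at most about rho_j^alpha, which
    is summable as soon as the rho_j decrease fast.  So u and v beat h along the
    sequence p_j, whatever h is, and the sums converge with all derivatives away
    from 0.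

    Near p_j, -Delta u has size rho_j^(alpha - kappa - 1) and v has size
    rho_j^(beta - kappa), so -Delta u <= v^lambda there requires
    kappa + 1 - alpha < (kappa - beta) lambda, and symmetrically
    kappa + 1 - beta < (kappa - alpha) sigma.  The hypotheses on lambda and
    sigma leave room for such alpha, beta > 0 ([exists_exponents]).

    Away from p_j the inequality could fail if -Delta E decayed too slowly.
    With tau = rho + |y|^2, the binomial series

      |y|^(-2 kappa) = (tau - rho)^(-kappa)
                     = sum_i coef_i rho^i tau^(-kappa - i)

    has positive coefficients.  Its sum is harmonic, so the Laplacian of a
    truncation telescopes ([laplacian_profile]):  the sum E_N up to i = N has
    -Delta E_N = const rho^(N+1) tau^(-kappa - N - 2), which is positive and
    decays as fast as desired.  For N large it decays faster than the power
    lambda of the tail tau^(-kappa) of the j-th term of v, and then the j-th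
    term of -Delta u is at most 2^(-j-1) v^lambda everywhere
    ([bubble_dominated]); summing over j gives -Delta u <= v^lambda
    ([laplacian_potential]).

    Smoothness comes from termwise differentiation ([is_derive_series]), which
    rests on dominated convergence for series ([tannery]).  The locally uniform
    bounds on all derivatives are read off a small syntax of expressions in rho,
    the coordinates and the powers of tau, which is closed under differentiation
    ([is_derive_eval], [eval_bounded]). *)

Set Implicit Arguments.
Unset Strict Implicit.
Unset Printing Implicit Defensive.

(** * Dominated series and termwise differentiation *)

Lemma series_tail_le (R : realType) (g b : R^nat) (N : nat) :
  (forall j, `|g j| <= b j) -> cvgn (series b) ->
  `|limn (series g) - series g N| <= limn (series b) - series b N.
Proof.
move=> gb cb.
have cg : cvgn (series g).
  apply: normed_cvg; apply: (series_le_cvg _ _ gb cb) => j //.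
  exact: le_trans (gb j).
have gN : `|series g M - series g N| @[M --> \oo] -->
    `|limn (series g) - series g N|.
  by apply: cvg_norm; apply: cvgB => //; exact: cvg_cst.
have bN : series b M - series b N @[M --> \oo] --> limn (series b) - series b N.
  by apply: cvgB => //; exact: cvg_cst.
apply: (ler_cvg_to gN bN); near=> M.
have NM : (N <= M)%N by near: M; exact: nbhs_infty_ge.
rewrite !sub_series NM.
by apply: le_trans (ler_norm_sum _ _ _) _; apply: ler_sum.
Unshelve. all: by end_near. Qed.

(** Dominated convergence for series.  Taking the limit along an arbitrary filter
    lets the same statement serve for the continuity of a sum (neighbourhoods of
    a point) and for its derivative (difference quotients, with a step tending
    to 0). *)
Lemma tannery (R : realType) (T : Type) (F : set_system T) (FF : ProperFilter F)
    (f : nat -> T -> R) (l b : R^nat) :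
  (forall j, f j t @[t --> F] --> l j) ->
  (\forall t \near F, forall j, `|f j t| <= b j) -> cvgn (series b) ->
  limn (series (f ^~ t)) @[t --> F] --> limn (series l).
Proof.
move=> fl fb cb.
have lb j : `|l j| <= b j.
  apply: (cvgr_to_le (cvg_norm (fl j))).
  by apply: filterS fb => t /(_ j).
apply/cvgrPdist_lt => e e0.
have e3 : 0 < e / 3 by rewrite divr_gt0.
have [N tailN] : exists N, limn (series b) - series b N < e / 3.
  have /cvgrPdist_lt/(_ _ e3)[N _ /(_ N (leqnn N)) /=] := cb.
  by exists N; exact: le_lt_trans (ler_norm _) _.
have partial : series (f ^~ t) N @[t --> F] --> series l N.
  by apply: cvg_big => //; exact: add_continuous.
have /cvgrPdist_lt/(_ _ e3) partial_e := partial.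
near=> t.
have ftb : forall j, `|f j t| <= b j by near: t.
have h1 := series_tail_le N lb cb.
have h2 := series_tail_le N ftb cb.
have h3 : `|series l N - series (f ^~ t) N| < e / 3 by near: t; exact: partial_e.
have -> : limn (series l) - limn (series (f ^~ t)) =
  (limn (series l) - series l N) + (series l N - series (f ^~ t) N)
   - (limn (series (f ^~ t)) - series (f ^~ t) N) by ring.
apply: le_lt_trans (ler_normB _ _) _.
apply: le_lt_trans (lerD (ler_normD _ _) (lexx _)) _.
lra.
Unshelve. all: by end_near. Qed.

(** A directional derivative at any point of a line is an ordinary derivative
    along that line; this gives access to the mean value theorem. *)
Lemma is_derive_line (R : realType) (V : normedModType R) (f : V -> R)
    (x v : V) (h df : R) :
  is_derive (h *: v + x) v f df <-> is_derive h 1 (fun t => f (t *: v + x)) df.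
Proof.
have E : (fun t => t^-1 *: ((f \o shift (h *: v + x)) (t *: v) - f (h *: v + x)))
  = (fun t => t^-1 *: (((fun t => f (t *: v + x)) \o shift h) (t *: 1)
       - (fun t => f (t *: v + x)) h)).
  by apply/funext => t /=; rewrite [t *: 1]mulr1 scalerDl addrA.
by split=> -[D1 D2]; split; move: D1 D2; rewrite /derivable /derive E.
Qed.

Lemma is_derive_line0 (R : realType) (V : normedModType R) (f : V -> R)
    (x v : V) (df : R) :
  is_derive (0 : R) 1 (fun t => f (t *: v + x)) df -> is_derive x v f df.
Proof. by move/is_derive_line; rewrite scale0r add0r. Qed.

Lemma increment_le (R : realType) (f df : R -> R) (b d : R) (h : R) :
  (forall t : R, `|t| < d -> is_derive t 1 f (df t) /\ `|df t| <= b) ->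
  `|h| < d -> `|f h - f 0| <= b * `|h|.
Proof.
move=> fd hd.
have cf t : `|t| < d -> {for t, continuous f}.
  move=> /fd[ft _]; apply/differentiable_continuous/derivable1_diffP.
  exact: ex_derive.
have [h0|h0] := leP 0 h.
- have inI t : t \in `[0, h]%R -> `|t| < d.
    by rewrite in_itv /= => /andP[t0 th]; rewrite ger0_norm// (le_lt_trans th)// -(ger0_norm h0).
  have [t| |c] := @MVT_segment R f df 0 h h0.
  + by move=> /subset_itv_oo_cc /inI /fd[].
  + apply: continuous_in_subspaceT => t; rewrite inE => /inI; exact: cf.
  move=> /inI/fd[_ dfc] ->; rewrite subr0 normrM; exact: ler_wpM2r.
- have inI t : t \in `[h, 0]%R -> `|t| < d.
    rewrite in_itv /= => /andP[th t0]; rewrite ler0_norm//.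
    by rewrite (le_lt_trans _ hd)// ltr0_norm// lerN2.
  have [t| |c] := @MVT_segment R f df h 0 (ltW h0).
  + by move=> /subset_itv_oo_cc /inI /fd[].
  + apply: continuous_in_subspaceT => t; rewrite inE => /inI; exact: cf.
  move=> /inI/fd[_ dfc]; rewrite distrC => ->.
  rewrite sub0r normrM normrN; exact: ler_wpM2r.
Qed.

(** By the mean value theorem the difference quotients of [f j] obey the same
    bound [b j] as the derivatives, so [tannery] applies to them. *)
Lemma is_derive_series (R : realType) (V : normedModType R)
    (f df : nat -> V -> R) (b : R^nat) (x v : V) :
  (\forall y \near x, cvgn (series (f ^~ y))) ->
  (\forall y \near x, forall j,
     is_derive y v (f j) (df j y) /\ `|df j y| <= b j) ->
  cvgn (series b) ->
  is_derive x v (fun y => limn (series (f ^~ y))) (limn (series (df ^~ x))).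
Proof.
move=> fcvg fd cb.
have lineE (P : V -> Prop) : (\forall y \near x, P y) ->
    \forall t \near (0 : R), P (t *: v + x).
  move=> Px; have : (fun t : R => t *: v + x) @ (0 : R) --> (x : V).
    rewrite -[X in _ --> X]add0r -(scale0r v).
    by apply: cvgD; [apply: cvgZr_tmp; exact: cvg_id | exact: cvg_cst].
  exact.
have [d /= d0 fdd] : exists2 d, 0 < d & forall t : R, `|t| < d -> forall j,
    is_derive (t *: v + x) v (f j) (df j (t *: v + x)) /\ `|df j (t *: v + x)| <= b j.
  have /nbhs0P/nbhs_normP[d /= d0 H] := lineE _ fd.
  exists d; [exact: d0 | move=> t td].
  by have := H t; rewrite /= sub0r normrN add0r => /(_ td).
have fcvg0 := lineE _ fcvg.
pose q j t := t^-1 *: ((f j \o shift x) (t *: v) - f j x).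
have qlim : limn (series (q ^~ t)) @[t --> (0 : R)^'] --> limn (series (df ^~ x)).
  apply: (@tannery _ _ _ _ _ _ b) => //.
  - move=> j; have [] := fdd 0 _ j; rewrite ?normr0// scale0r add0r => -[fj <-] _.
    exact: fj.
  - near=> t => j.
    have td : `|t| < d.
      near: t; apply: dnbhs0_lt => //.
    have t0 : t != 0 by near: t; exact: nbhs_dnbhs_neq.
    have := @increment_le _ (fun t => f j (t *: v + x)) (fun t => df j (t *: v + x)) (b j) d t.
    move=> /(_ _ td); rewrite scale0r add0r => H.
    rewrite /q /= normrZ normfV mulrC ler_pdivrMr ?normr_gt0//; apply: H => s /fdd /(_ j)[Ds bs].
    by split; [exact: (proj1 (is_derive_line (f j) x v s _) Ds) | exact: bs].
have E : \forall t \near (0 : R)^', t^-1 *: ((fun y => limn (series (f ^~ y))) \o shift x) (t *: v)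
   - t^-1 *: limn (series (f ^~ x)) = limn (series (q ^~ t)).
  near=> t.
  have c1 : cvgn (series (f ^~ (t *: v + x))).
    by near: t; apply: nbhs_dnbhs.
  have c0 : cvgn (series (f ^~ x)) by exact: (nbhs_singleton fcvg).
  rewrite -scalerBr /= -lim_seriesB// -lim_seriesZ; last exact: is_cvg_seriesB.
  congr (limn (series _)).
have qlim' : t^-1 *: (((fun y => limn (series (f ^~ y))) \o shift x) (t *: v)
   - limn (series (f ^~ x))) @[t --> (0 : R)^'] --> limn (series (df ^~ x)).
  apply: cvg_trans qlim; apply: near_eq_cvg; apply: filterS E => t <-.
  by rewrite scalerBr.
split; first by apply/cvg_ex; exists (limn (series (df ^~ x))).
exact: cvg_lim qlim'.
Unshelve. all: by end_near. Qed.

(** * Expressions in rho, the coordinates and powers of rho + |y|^2 *)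

Definition sqnorm (R : realType) (n : nat) (y : 'rV[R]_n) : R :=
  \sum_(i < n) y 0 i ^+ 2.

(** [Mono c m] stands for c rho^m and [Pow k] for (rho + |y|^2)^(-k).  The
    syntax is closed under differentiation, so a bound valid for every
    expression is at once a bound for the derivatives of all orders; carrying
    rho as a variable makes these bounds uniform in rho. *)
Inductive expr (R : realType) (n : nat) : Type :=
  | Mono of R & nat
  | Coord of 'I_n
  | Pow of R
  | Add of expr R n & expr R n
  | Mul of expr R n & expr R n.

Arguments Mono {R n}.
Arguments Coord {R n}.
Arguments Pow {R n}.

Fixpoint eval (R : realType) (n : nat) (e : expr R n) (rho : R)
    (y : 'rV[R]_n) : R :=
  match e with
  | Mono c m => c * rho ^+ m
  | Coord i => y 0 i
  | Pow k => (rho + sqnorm y) `^ (- k)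
  | Add e1 e2 => eval e1 rho y + eval e2 rho y
  | Mul e1 e2 => eval e1 rho y * eval e2 rho y
  end.

Fixpoint pd (R : realType) (n : nat) (i : 'I_n) (e : expr R n) : expr R n :=
  match e with
  | Mono _ _ => Mono 0 0
  | Coord j => Mono (i == j)%:R 0
  | Pow k => Mul (Mono (- (2 * k)) 0) (Mul (Coord i) (Pow (k + 1)))
  | Add e1 e2 => Add (pd i e1) (pd i e2)
  | Mul e1 e2 => Add (Mul (pd i e1) e2) (Mul e1 (pd i e2))
  end.

Section Expr.
Variables (R : realType) (n : nat).
Implicit Types (y : 'rV[R]_n) (e : expr R n).

Lemma sqnorm_ge0 y : 0 <= sqnorm y.
Proof. by apply: sumr_ge0 => i _; exact: sqr_ge0. Qed.

Lemma coord_le_norm y i : `|y 0 i| <= `|y|.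
Proof.
rewrite [leRHS]/Num.norm /= mx_normrE; apply/bigmax_geP; right => /=.
by exists (0, i).
Qed.

Lemma sqnorm_ge_norm y : `|y| ^+ 2 <= sqnorm y.
Proof.
have [->|y0] := eqVneq y 0; first by rewrite normr0 expr0n sqnorm_ge0.
have [|[j i] /= E] := @mx_norm_neq0 _ _ _ y.
  by rewrite -[mx_norm y]/(`|y|) normr_eq0.
rewrite [`|y|]E (ord1 j) real_normK ?num_real// /sqnorm (bigD1 i)//= lerDl.
by apply: sumr_ge0 => k _; exact: sqr_ge0.
Qed.

Lemma sqnorm_le y (D : R) : `|y| <= D -> sqnorm y <= n%:R * D ^+ 2.
Proof.
move=> yD; apply: (@le_trans _ _ (\sum_(i < n) D ^+ 2)).
  apply: ler_sum => i _; rewrite -[y 0 i ^+ 2]real_normK ?num_real//.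
  by rewrite lerXn2r ?nnegrE ?(le_trans _ yD)//; exact: coord_le_norm.
by rewrite sumr_const card_ord mulr_natl.
Qed.

(** The squared norm is quadratic along coordinate lines, which reduces the
    partial derivatives of its powers to one-variable calculus. *)
Lemma sqnorm_line y i (t : R) :
  sqnorm (t *: delta_mx 0 i + y) = sqnorm y + 2 * y 0 i * t + t ^+ 2.
Proof.
rewrite /sqnorm [LHS](bigD1 i)//= [in RHS](bigD1 i)//= !mxE !eqxx /= mulr1.
under eq_bigr => j ji do rewrite !mxE eqxx (negbTE ji) /= mulr0 add0r.
by ring.
Qed.

Lemma is_derive_eval e (i : 'I_n) (rho : R) (y : 'rV[R]_n) : 0 < rho ->
  is_derive y (delta_mx 0 i) (eval e rho) (eval (pd i e) rho y).
Proof.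
move=> rho0; elim: e => [c m|j|k|e1 IH1 e2 IH2|e1 IH1 e2 IH2] /=.
- by rewrite mul0r; exact: is_derive_cst.
- rewrite expr0 mulr1.
  apply: is_derive_line0.
  have -> : (fun t : R => (t *: delta_mx 0 i + y) 0 j)
      = (i == j)%:R \*: id + cst (y 0 j).
    by apply/funext => t; rewrite !mxE /= eq_sym mulrC.
  by apply: is_derive_eq; rewrite addr0 [_ *: _]mulr1.
- apply: is_derive_line0.
  pose tau := cst (rho + sqnorm y) + (2 * y 0 i) \*: id + (@id R) ^+ 2.
  have tau0 : tau 0 = rho + sqnorm y.
    by rewrite /tau !fctE /= scaler0 expr0n !addr0.
  have -> : (fun t : R => (rho + sqnorm (t *: delta_mx 0 i + y)) `^ (- k))
     = (fun s => s `^ (- k)) \o tau.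
    by apply/funext => t; rewrite sqnorm_line !addrA.
  have Dtau : is_derive (0 : R) 1 tau (2 * y 0 i).
    by apply: is_derive_eq; rewrite expr1 mulr0 scale0r add0r addr0 [_ *: _]mulr1.
  have tau_gt0 : 0 < tau 0 by rewrite tau0 ltr_wpDr// sqnorm_ge0.
  apply: (is_derive_eq (is_derive1_comp (is_derive1_powR _ tau_gt0) Dtau)).
  by rewrite tau0 expr0 mulr1 opprD; ring.
- exact: is_deriveD.
- by apply: is_derive_eq; rewrite /= addrC; congr (_ + _); rewrite mulrC.
Qed.

(** Bounding rho + |y|^2 from below, rather than |y|, covers both a point y far
    from 0 with rho arbitrarily small and a y near 0 with rho bounded below. *)
Lemma eval_bounded e (m D : R) : 0 < m ->
  exists2 C : R, 0 <= C & forall (rho : R) y, 0 <= rho <= 1 -> m <= rho + sqnorm y ->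
    `|y| <= D -> `|eval e rho y| <= C.
Proof.
move=> m0; elim: e => [c k|j|k|e1 [C1 C10 H1] e2 [C2 C20 H2]|e1 [C1 C10 H1] e2 [C2 C20 H2]] /=.
- exists `|c| => // rho y /andP[r0 r1] _ _.
  by rewrite normrM ler_piMr// normrX exprn_ile1// ger0_norm.
- exists `|D| => // rho y _ _ yD.
  by apply: le_trans (coord_le_norm _ _) _; apply: le_trans yD (ler_norm _).
- exists (m `^ (- k) + (1 + n%:R * D ^+ 2) `^ (- k)).
    by rewrite addr_ge0// powR_ge0.
  move=> rho y /andP[r0 r1] mt /sqnorm_le yD.
  have t0 : 0 < rho + sqnorm y by exact: lt_le_trans mt.
  rewrite ger0_norm ?powR_ge0//.
  have [k0|k0] := leP 0 k.
    rewrite -[leLHS]addr0 lerD ?powR_ge0// !powRN lef_pV2 ?posrE ?powR_gt0//.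
    by apply: ge0_ler_powR => //; rewrite nnegrE ltW.
  rewrite -[leLHS]add0r lerD ?powR_ge0//.
  apply: ge0_ler_powR.
  + by rewrite oppr_ge0 ltW.
  + by rewrite nnegrE ltW.
  + by rewrite nnegrE addr_ge0// mulr_ge0// sqr_ge0.
  + exact: lerD.
- exists (C1 + C2); first exact: addr_ge0.
  move=> rho y r01 mt yD; apply: le_trans (ler_normD _ _) _.
  by apply: lerD; [exact: H1|exact: H2].
- exists (C1 * C2); first exact: mulr_ge0.
  by move=> rho y r01 mt yD; rewrite normrM ler_pM//; [exact: H1|exact: H2].
Qed.

Lemma continuous_eval e (rho : R) : 0 < rho -> continuous (eval e rho).
Proof.
move=> rho0; elim: e => [c m|j|k|e1 IH1 e2 IH2|e1 IH1 e2 IH2] y.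
- exact: cst_continuous.
- exact: coord_continuous.
- have sq : continuous (@sqnorm R n).
    apply: continuous_big => [|i _ z]; first exact: add_continuous.
    have zi := @coord_continuous R 1 n 0 i z.
    exact: (cvgM zi zi).
  apply: (@continuous_comp _ _ _ (fun y => rho + sqnorm y) (fun s : R => s `^ (- k))).
    by apply: cvgD (sq y); exact: cvg_cst.
  apply/differentiable_continuous/derivable1_diffP.
  by apply: derivable_powR; rewrite in_itv /= andbT ltr_wpDr// sqnorm_ge0.
- exact: cvgD (IH1 y) (IH2 y).
- exact: cvgM (IH1 y) (IH2 y).
Qed.

End Expr.

(** * Superpositions of translated expressions *)

Lemma is_derive_translate (R : realType) (V : normedModType R) (f : V -> R)
    (c x v : V) (df : R) :
  is_derive (x - c) v f df -> is_derive x v (fun y => f (y - c)) df.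
Proof.
have E : (fun t => t^-1 *: ((f \o shift (x - c)) (t *: v) - f (x - c)))
  = (fun t => t^-1 *: (((fun y => f (y - c)) \o shift x) (t *: v) - f (x - c))).
  by apply/funext => t /=; rewrite addrA.
by move=> -[D1 D2]; split; move: D1 D2; rewrite /derivable /derive E.
Qed.

Lemma near_neq0 (R : realType) (n : nat) (x : 'rV[R]_n) :
  x != 0 -> \forall y \near x, y != 0.
Proof. exact: (@cvgr_neq0 _ _ _ (nbhs x) _ id x cvg_id). Qed.

Definition superpose (R : realType) (n : nat) (a rho : R^nat)
    (p : nat -> 'rV[R]_n) (e : expr R n) (x : 'rV[R]_n) : R :=
  limn (series (fun j => a j * eval e (rho j) (x - p j))).

Section Superpose.
Variables (R : realType) (n : nat) (a b rho : R^nat) (p : nat -> 'rV[R]_n).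
Hypothesis rho01 : forall j, 0 < rho j <= 1.
Hypothesis p_le1 : forall j, `|p j| <= 1.
Hypothesis p_cvg0 : p j @[j --> \oo] --> (0 : 'rV[R]_n).
Hypothesis ab : forall j, `|a j| <= b j.
Hypothesis cvgb : cvgn (series b).
Implicit Types (x : 'rV[R]_n) (e : expr R n).

Let rho_gt0 j : 0 < rho j. Proof. by have /andP[] := rho01 j. Qed.

(** Only finitely many centers lie away from 0; those have rho j bounded below,
    and all the others are far from a neighbourhood of x. *)
Lemma near_away_from_centers x : x != 0 ->
  exists m D : R, 0 < m /\ \forall y \near x, forall j,
    m <= rho j + sqnorm (y - p j) /\ `|y - p j| <= D.
Proof.
move=> x0; pose d := `|x| / 4.
have d0 : 0 < d by rewrite divr_gt0// normr_gt0.
have xd : `|x| = 4 * d by rewrite /d; field.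
have [J _ pJ] : \forall j \near \oo, `|p j| < d.
  by have /cvgr0Pnorm_lt := p_cvg0; exact.
have [m0 m0_gt0 m0_le] : exists2 m0 : R, 0 < m0 & forall j, (j < J)%N -> m0 <= rho j.
  elim: J {pJ} => [|J [m m0 mJ]]; first by exists 1.
  exists (Num.min m (rho J)); first by rewrite lt_min m0 rho_gt0.
  move=> j; rewrite ltnS leq_eqVlt => /predU1P[->|/mJ mj].
    by rewrite ge_min lexx orbT.
  by rewrite ge_min mj.
exists (Num.min m0 (d ^+ 2)), (5 * d + 1); split.
  by rewrite lt_min m0_gt0 exprn_gt0.
near=> y => j.
have xy : `|x - y| < d by near: y; exact: cvgr_dist_lt.
split; last first.
  have -> : y - p j = x - (x - y) - p j by rewrite subKr.
  apply: le_trans (ler_normB _ _) _; apply: lerD => //.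
  by apply: le_trans (ler_normB _ _) _; lra.
rewrite ge_min; have [jJ|Jj] := ltnP j J.
  by rewrite ler_wpDr ?sqnorm_ge0 ?m0_le.
apply/orP; right; apply: ler_wpDl; first exact: ltW.
apply: le_trans (sqnorm_ge_norm _).
rewrite lerXn2r ?nnegrE ?(ltW d0)//.
have pd : `|p j| < d by exact: pJ.
have : `|x| <= `|y - p j| + `|x - y| + `|p j|.
  have {1}-> : x = (y - p j) + (x - y) + p j by rewrite addrAC subrK addrC subrK.
  apply: le_trans (ler_normD _ _) _; apply: lerD => //; exact: ler_normD.
lra.
Unshelve. all: by end_near. Qed.

Lemma superpose_dominated e x : x != 0 ->
  exists2 C : R, 0 <= C & \forall y \near x, forall j,
    `|a j * eval e (rho j) (y - p j)| <= C * b j.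
Proof.
move=> /near_away_from_centers[m [D [m0 xmD]]].
have [C C0 HC] := eval_bounded e D m0.
exists C => //; apply: filterS xmD => y ymD j; have [mj Dj] := ymD j.
rewrite normrM mulrC ler_pM//; apply: HC => //.
by have /andP[r0 ->] := rho01 j; rewrite ltW.
Qed.

Lemma cvg_dominator (C : R) : cvgn (series (fun j => C * b j)).
Proof. exact: (@is_cvg_seriesZ _ b C). Qed.

Lemma superpose_cvg e x : x != 0 ->
  cvgn (series (fun j => a j * eval e (rho j) (x - p j))).
Proof.
move=> /(superpose_dominated e)[C C0 /nbhs_singleton H].
apply: normed_cvg => /=.
apply: (series_le_cvg _ _ H (@cvg_dominator C)) => j //.
exact: le_trans (H j).
Qed.

Lemma continuous_superpose e x : x != 0 ->
  {for x, continuous (superpose a rho p e)}.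
Proof.
move=> x0; have [C C0 H] := superpose_dominated e x0.
apply: (@tannery _ _ (nbhs x) _ _ _ (fun j => C * b j)) => [j||].
- have shiftc : {for x, continuous (fun y : 'rV[R]_n => y - p j)}.
    by apply: (@cvgB _ _ _ (nbhs x) _ id (cst (p j))); [exact: cvg_id | exact: cvg_cst].
  have evalc : {for x, continuous (fun y : 'rV[R]_n => eval e (rho j) (y - p j))}.
    by apply: (continuous_comp shiftc); exact: continuous_eval.
  by apply: cvgM evalc; exact: cvg_cst.
- exact: H.
- exact: cvg_dominator.
Qed.

Lemma is_derive_superpose e i x : x != 0 ->
  is_derive x (delta_mx 0 i) (superpose a rho p e) (superpose a rho p (pd i e) x).
Proof.
move=> x0; have [C C0 H] := superpose_dominated (pd i e) x0.
apply: (@is_derive_series _ _ (fun j y => a j * eval e (rho j) (y - p j))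
   (fun j y => a j * eval (pd i e) (rho j) (y - p j)) (fun j => C * b j)).
- by apply: filterS (near_neq0 x0) => y; exact: superpose_cvg.
- apply: filterS H => y Hy j; split; last exact: Hy.
  apply: (@is_deriveZ _ _ _ (fun y => eval e (rho j) (y - p j)) (a j)).
  by apply: is_derive_translate; exact: is_derive_eval.
- exact: cvg_dominator.
Qed.

(** The additive constant survives only when no derivative is taken, hence the
    factor [nilp s]. *)
Lemma pderivs_superpose c e s x : x != 0 ->
  pderivs s (fun y => c + superpose a rho p e y) x =
  c *+ nilp s + superpose a rho p (foldr (@pd R n) e s) x.
Proof.
elim: s x => [//|i s IH] x x0 /=.
rewrite /pderiv -/(pderivs s _) mulr0n add0r.
rewrite (near_eq_derive _ (g := cst (c *+ nilp s) + superpose a rho p (foldr (@pd R n) e s))).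
  have D := is_derive_superpose (foldr (@pd R n) e s) i x0.
  by rewrite derive_val add0r.
by apply: filterS (near_neq0 x0) => y; exact: IH.
Qed.

Lemma smooth_superpose c e :
  smooth_on (~` [set 0]) (fun x => c + superpose a rho p e x).
Proof.
move=> s x /= /eqP x0.
pose g := cst (c *+ nilp s) + superpose a rho p (foldr (@pd R n) e s).
have E : \forall y \near x, g y = pderivs s (fun x => c + superpose a rho p e x) y.
  by near=> y; rewrite pderivs_superpose//; near: y; exact: near_neq0.
split=> [|i].
  have gc : {for x, continuous g}.
    apply: (@cvgD _ _ _ (nbhs x) _ (cst _) (superpose a rho p _)).
      exact: cvg_cst.
    exact: continuous_superpose.
  have gx := nbhs_singleton E.
  by rewrite /prop_for /continuous_at -gx; exact: cvg_trans (near_eq_cvg E) gc.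
apply: (near_eq_derivable E).
apply: derivableD; first exact: derivable_cst.
by have [] := is_derive_superpose (foldr (@pd R n) e s) i x0.
Unshelve. all: by end_near. Qed.

Lemma laplacian_superpose c e x : x != 0 ->
  laplacian (fun y => c + superpose a rho p e y) x =
  limn (series (fun j => a j * \sum_(i < n) eval (pd i (pd i e)) (rho j) (x - p j))).
Proof.
move=> x0; rewrite /laplacian.
under eq_bigr => i _ do
  rewrite -[pderiv i _]/(pderivs [:: i; i] _) pderivs_superpose// mulr0n add0r.
apply/esym/cvg_lim => //.
have -> : series (fun j => a j * \sum_(i < n) eval (pd i (pd i e)) (rho j) (x - p j))
  = (fun N => \sum_(i < n) series (fun j => a j * eval (pd i (pd i e)) (rho j) (x - p j)) N).
  apply/funext => N; rewrite /series /= exchange_big /=.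
  by apply: eq_bigr => j _; rewrite mulr_sumr.
apply: cvg_big => [|i _]; first exact: add_continuous.
exact: superpose_cvg.
Qed.

End Superpose.

(** * The bubble profile *)

Section Profile.
Variables (R : realType) (n : nat) (kappa : R).
Hypothesis kappa_gt0 : 0 < kappa.
Hypothesis dim_kappa : n%:R = 2 * kappa + 2.
Implicit Types (y : 'rV[R]_n).

(** The coefficients of the binomial series of (1 - t)^(-kappa). *)
Fixpoint coef (i : nat) : R :=
  if i is i'.+1 then coef i' * (kappa + i'%:R) / i'.+1%:R else 1.

(** The truncation at order N of the expansion of |y|^(-2 kappa) in powers of
    rho / (rho + |y|^2). *)
Fixpoint profile (N : nat) : expr R n :=
  if N is N'.+1 then
    Add (profile N') (Mul (Mono (coef N) N) (Pow (kappa + N%:R)))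
  else Pow kappa.

Lemma coef_gt0 i : 0 < coef i.
Proof.
elim: i => [//|i IH] /=; rewrite divr_gt0// mulr_gt0//.
by rewrite ltr_pwDl.
Qed.

Lemma profile_ge N (rho : R) y : 0 < rho ->
  (rho + sqnorm y) `^ (- kappa) <= eval (profile N) rho y.
Proof.
move=> rho0; elim: N => [//|N IH] /=.
apply: (le_trans IH); rewrite lerDl mulr_ge0 ?powR_ge0// mulr_ge0 ?exprn_ge0 ?(ltW rho0)//.
exact: ltW (coef_gt0 N.+1).
Qed.

Lemma laplacian_Pow (k rho : R) y : 0 < rho ->
  \sum_(i < n) eval (pd i (pd i (Pow k))) rho y =
  2 * k * (2 * k + 2 - n%:R) * (rho + sqnorm y) `^ (- (k + 1))
  - 4 * k * (k + 1) * rho * (rho + sqnorm y) `^ (- (k + 2)).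
Proof.
move=> rho0; set tau := rho + sqnorm y.
have tau0 : 0 < tau by rewrite ltr_wpDr// sqnorm_ge0.
pose P1 := tau `^ (- (k + 1)); pose P2 := tau `^ (- (k + 2)).
have tauP2 : tau * P2 = P1.
  rewrite /P2 -{1}(powRr1 (ltW tau0)) -powRD; first by congr (_ `^ _); ring.
  by rewrite (gt_eqF tau0) implybT.
rewrite (eq_bigr (fun i => - (2 * k) * P1 + 4 * k * (k + 1) * P2 * y 0 i ^+ 2)); last first.
  move=> i _ /=; rewrite eqxx expr0 -/tau -/P1.
  have -> : k + 1 + 1 = k + 2 by ring.
  by rewrite -/P2 (_ : true%:R = 1 :> R)//; ring.
have sqE : \sum_(i < n) y 0 i ^+ 2 = tau - rho by rewrite /tau addrAC subrr add0r.
rewrite big_split /= -!mulr_sumr sqE sumr_const card_ord -[P1 *+ n]mulr_natr.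
by rewrite -/P1 -/P2 -tauP2; ring.
Qed.

Lemma eval_pd2_scaled (c : R) m e i rho y :
  eval (pd i (pd i (Mul (Mono c m) e))) rho y = c * rho ^+ m * eval (pd i (pd i e)) rho y.
Proof. by rewrite /=; ring. Qed.

(** By [laplacian_Pow] the i-th term contributes one power of tau that cancels
    the contribution of term i - 1, thanks to coef_(i+1) (i+1) =
    coef_i (kappa + i), and one that passes on to term i + 1; only the last one
    remains. *)
Lemma laplacian_profile N (rho : R) y : 0 < rho ->
  \sum_(i < n) eval (pd i (pd i (profile N))) rho y =
  - (4 * coef N * (kappa + N%:R) * (kappa + N%:R + 1) * rho ^+ N.+1
     * (rho + sqnorm y) `^ (- (kappa + N%:R + 2))).
Proof.
move=> rho0; elim: N => [|N IH].
  by rewrite laplacian_Pow// dim_kappa /= addr0 expr1; ring.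
rewrite (eq_bigr (fun i => eval (pd i (pd i (profile N))) rho y
  + coef N.+1 * rho ^+ N.+1 * eval (pd i (pd i (Pow (kappa + N.+1%:R)))) rho y)); last first.
  by move=> i _; rewrite -eval_pd2_scaled.
rewrite big_split /= IH -mulr_sumr laplacian_Pow// dim_kappa -/(coef N.+1).
have E : kappa + N.+1%:R + 1 = kappa + N%:R + 2 by rewrite -natr1; ring.
rewrite E.
set P1 := _ `^ (- (kappa + N%:R + 2)); set P2 := _ `^ (- (kappa + N.+1%:R + 2)).
have cE : coef N.+1 * N.+1%:R = coef N * (kappa + N%:R).
  by rewrite /= divfK// pnatr_eq0.
have -> : 4 * coef N * (kappa + N%:R) = 4 * (coef N.+1 * N.+1%:R) by rewrite cE; ring.
rewrite -/(coef N.+1); set c := coef N.+1; rewrite !exprS -[N.+1%:R]natr1; ring.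
Qed.

End Profile.

(** For N this large the quotient of the two sides decreases in tau, so the
    worst case is the center of the bubble, tau = rho; there the claim is the
    inequality between powers of rho assumed last. *)
Lemma bubble_dominated (R : realType) (kappa alpha beta mu C eps rho tau : R) (N : nat) :
  0 <= C -> 0 < rho -> rho <= tau -> kappa * mu <= kappa + N%:R + 2 ->
  C * rho `^ (alpha - kappa - 1 + (kappa - beta) * mu) <= eps ->
  rho `^ alpha * (C * rho ^+ N.+1 * tau `^ (- (kappa + N%:R + 2)))
    <= eps * (rho `^ beta * tau `^ (- kappa)) `^ mu.
Proof.
move=> C0 rho0 rho_tau Nbig Ceps.
have tau0 : 0 < tau by exact: lt_le_trans rho_tau.
have rhoD a b : rho `^ (a + b) = rho `^ a * rho `^ b.
  by apply: powRD; rewrite (gt_eqF rho0) implybT.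
have tauD a b : tau `^ (a + b) = tau `^ a * tau `^ b.
  by apply: powRD; rewrite (gt_eqF tau0) implybT.
rewrite powRM ?powR_ge0// -!powRrM -powR_mulrn ?(ltW rho0)//.
set d := kappa + N%:R + 2 - kappa * mu.
have -> : - (kappa + N%:R + 2) = - kappa * mu + - d by rewrite /d; ring.
have d_ge0 : 0 <= d by rewrite /d subr_ge0.
have taud : tau `^ (- d) <= rho `^ (- d).
  rewrite !powRN lef_pV2 ?posrE ?powR_gt0//.
  by apply: ge0_ler_powR; rewrite ?nnegrE ?(ltW rho0) ?(ltW tau0).
rewrite tauD.
apply: (@le_trans _ _ (C * (rho `^ alpha * rho `^ N.+1%:R * rho `^ (- d)) * tau `^ (- kappa * mu))).
  rewrite (_ : _ * _ = C * (rho `^ alpha * rho `^ N.+1%:R * tau `^ (- d)) * tau `^ (- kappa * mu)); last by ring.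
  apply: ler_wpM2r; first exact: powR_ge0.
  apply: ler_wpM2l => //; apply: ler_wpM2l => //.
  by rewrite mulr_ge0 ?powR_ge0.
rewrite -!rhoD.
rewrite (_ : alpha + N.+1%:R - d = alpha - kappa - 1 + (kappa - beta) * mu + beta * mu); last first.
  by rewrite /d -natr1; ring.
rewrite rhoD !mulrA -[leRHS]mulrA -[leLHS]mulrA.
by apply: ler_wpM2r => //; rewrite mulr_ge0 ?powR_ge0.
Qed.


(** * Choice of the exponents *)

(** The lower bound for sigma gives room for beta between
    kappa + 1 - kappa sigma and kappa - (kappa + 1) / lambda.  That the latter is
    positive is where sigma <= lambda enters.  The two gap conditions are strict
    at alpha = 0, so they persist for a small positive alpha. *)
Lemma exists_exponents (R : realType) (kappa lambda sigma : R) :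
  0 < kappa -> 0 < lambda -> 0 < sigma -> sigma <= lambda ->
  1 / kappa + (kappa + 1) / kappa * (1 / lambda) < sigma ->
  exists alpha beta : R,
    [/\ 0 < alpha < kappa, 0 < beta < kappa,
        kappa + 1 - alpha < (kappa - beta) * lambda
      & kappa + 1 - beta < (kappa - alpha) * sigma].
Proof.
move=> k0 l0 s0 sl H.
have H1 : lambda + kappa + 1 < sigma * kappa * lambda.
  have kl0 : 0 < kappa * lambda by rewrite mulr_gt0.
  have := H; rewrite -(ltr_pM2r kl0).
  have -> : (1 / kappa + (kappa + 1) / kappa * (1 / lambda)) * (kappa * lambda) = lambda + kappa + 1.
    by field; rewrite !gt_eqF.
  by rewrite mulrA.
(* Otherwise sigma kappa <= lambda kappa <= kappa + 1, against H1. *)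
have H2 : kappa + 1 < kappa * lambda.
  rewrite ltNge; apply/negP => kl.
  have h1 : sigma * (kappa * lambda) <= lambda * (kappa * lambda) by rewrite ler_pM2r// mulr_gt0.
  have h2 : lambda * (kappa * lambda) <= lambda * (kappa + 1) by rewrite ler_pM2l.
  have h3 : sigma * kappa * lambda <= kappa * lambda + lambda by lra.
  have : kappa + 1 < kappa * lambda by lra.
  lra.
pose B := kappa - (kappa + 1) / lambda.
have Bl : B * lambda = kappa * lambda - (kappa + 1).
  by rewrite /B mulrBl divfK ?gt_eqF.
have B0 : 0 < B by rewrite -(pmulr_lgt0 _ l0) Bl subr_gt0.
pose A := kappa + 1 - kappa * sigma.
have AB : A < B by rewrite -(ltr_pM2r l0) Bl /A; lra.
pose beta := (Num.max 0 A + B) / 2.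
have [b0 bA bB] : [/\ 0 < beta, A < beta & beta < B].
  have m0 : 0 <= Num.max 0 A by rewrite le_max lexx.
  have mA : A <= Num.max 0 A by rewrite le_max lexx orbT.
  have mB : Num.max 0 A < B by rewrite gt_max B0 AB.
  by rewrite /beta; split; lra.
have Bk : B < kappa by rewrite /B ltrBlDr ltrDl divr_gt0// addr_gt0.
have bl : beta * lambda < kappa * lambda - (kappa + 1) by rewrite -Bl ltr_pM2r.
pose alpha := (kappa * sigma - (kappa + 1 - beta)) / (2 * sigma).
have as2 : alpha * sigma * 2 = kappa * sigma - (kappa + 1 - beta).
  by rewrite /alpha; field; rewrite gt_eqF.
have num0 : 0 < kappa * sigma - (kappa + 1 - beta) by move: bA; rewrite /A; lra.
have a0 : 0 < alpha by rewrite divr_gt0// mulr_gt0.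
exists alpha, beta; split.
- rewrite a0 /= -(ltr_pM2r s0); lra.
- by rewrite b0 (lt_trans bB).
- lra.
- lra.
Qed.

Lemma near0_powR_le (R : realType) (K e : R) : 0 < e ->
  \forall r \near (0 : R)^'+, K * r `^ e <= 1.
Proof.
move=> e0.
have H : K * r `^ e @[r --> (0 : R)^'+] --> K * 0.
  by apply: cvgM; [exact: cvg_cst | exact: powR_cvg0].
by apply: (cvgr_le _ H); rewrite mulr0.
Qed.

(** * Sums of bubbles *)

Lemma not_bigO_of_peaks (R : realType) (n : nat) (w g : 'rV[R]_n -> R)
    (p : nat -> 'rV[R]_n) :
  p j @[j --> \oo] --> (0 : 'rV[R]_n) -> (forall j, p j != 0) ->
  (forall j, 0 < g (p j)) -> (forall j, j.+1%:R * g (p j) <= w (p j)) ->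
  ~ (w =O_ ((0 : 'rV[R]_n)^') g).
Proof.
move=> p_cvg0 p0 g0 peak /eqOP[M [_ HM]].
pose K := Num.max (M + 1) 0.
have : \forall x \near (0 : 'rV[R]_n)^', `|w x| <= K * `|g x|.
  by apply: HM; rewrite lt_max ltrDl ltr01.
rewrite /= -/(nbhs _) => Hw.
have /p_cvg0 [J0 _ Jp] : nbhs (0 : 'rV[R]_n) (fun x => x != 0 -> `|w x| <= K * `|g x|) by exact: Hw.
pose J := maxn J0 (Num.bound K).
have := Jp J (leq_maxl _ _) (p0 J).
rewrite (gtr0_norm (g0 J)) => wJ.
have wK : J.+1%:R * g (p J) <= K * g (p J).
  by apply: le_trans wJ; apply: le_trans (peak J) (ler_norm _).
move: wK; rewrite ler_pM2r// => wK.
have K0 : 0 <= K by rewrite le_max lexx orbT.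
have := archi_boundP K0; rewrite ltNge => /negP; apply.
apply: le_trans wK; rewrite ler_nat; apply: leqW; exact: leq_maxr.
Qed.

Lemma term_le_lim_series (R : realType) (f : R^nat) (j : nat) :
  (forall k, 0 <= f k) -> cvgn (series f) -> f j <= limn (series f).
Proof.
move=> f0 cf; have nd : nondecreasing_seq (series f) by exact: nondecreasing_series.
apply: le_trans (nondecreasing_cvgn_le nd cf j.+1).
by rewrite seriesSr lerDr; apply: sumr_ge0 => k _.
Qed.

Section Bubbles.
Variables (R : realType) (n : nat) (kappa : R) (N : nat).
Variables (b rho : R^nat) (p : nat -> 'rV[R]_n).
Hypothesis kappa_gt0 : 0 < kappa.
Hypothesis dim_kappa : n%:R = 2 * kappa + 2.
Hypothesis rho01 : forall j, 0 < rho j <= 1.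
Hypothesis p_le1 : forall j, `|p j| <= 1.
Hypothesis p_cvg0 : p j @[j --> \oo] --> (0 : 'rV[R]_n).
Hypothesis b_sum : series b @ \oo --> (1 : R).

Let rho_gt0 j : 0 < rho j. Proof. by have /andP[] := rho01 j. Qed.

Let amplitude (alpha : R) j := rho j `^ alpha.
Let potential alpha := superpose (amplitude alpha) rho p (profile n kappa N).
Let C := 4 * coef kappa N * (kappa + N%:R) * (kappa + N%:R + 1).

Lemma potential_ge alpha j x : x != 0 ->
  (forall k, amplitude alpha k <= b k) ->
  amplitude alpha j * (rho j + sqnorm (x - p j)) `^ (- kappa) <= potential alpha x.
Proof.
move=> x0 ab.
apply: (@le_trans _ _ (amplitude alpha j * eval (profile n kappa N) (rho j) (x - p j))).
  by apply: ler_wpM2l; [exact: powR_ge0 | exact: profile_ge].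
apply: (@term_le_lim_series _ (fun j => amplitude alpha j * eval (profile n kappa N) (rho j) (x - p j))).
  move=> k; rewrite mulr_ge0 ?powR_ge0//.
  by apply: le_trans (profile_ge kappa_gt0 N (x - p k) (rho_gt0 k)); exact: powR_ge0.
apply: (@superpose_cvg _ _ _ b) => //; last exact: cvgP b_sum.
by move=> k; rewrite ger0_norm ?powR_ge0.
Qed.

(** Each term of -Delta u is at most b_j times the power mu of the j-th term of
    the other potential, hence at most b_j times the power mu of the whole; the
    b_j add up to 1. *)
Lemma laplacian_potential alpha beta mu x : x != 0 ->
  (forall j, amplitude alpha j <= b j) -> (forall j, amplitude beta j <= b j) ->
  0 < mu -> kappa * mu <= kappa + N%:R + 2 ->
  (forall j, C * rho j `^ (alpha - kappa - 1 + (kappa - beta) * mu) <= b j) ->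
  0 <= - laplacian (fun y => 2 + potential alpha y) x
    <= (2 + potential beta x) `^ mu.
Proof.
move=> x0 ab bb mu0 Nbig Cb.
have C0 : 0 <= C.
  rewrite /C -!mulrA mulr_ge0// mulr_ge0 ?(ltW (coef_gt0 kappa_gt0 N))//.
  by rewrite mulr_ge0// !addr_ge0// ltW.
have b0 j : 0 <= b j by apply: le_trans (ab j); exact: powR_ge0.
have cb : cvgn (series b) by exact: cvgP b_sum.
pose T j := amplitude alpha j * (C * rho j ^+ N.+1 *
  (rho j + sqnorm (x - p j)) `^ (- (kappa + N%:R + 2))).
have T0 j : 0 <= T j.
  rewrite mulr_ge0 ?powR_ge0// mulr_ge0 ?powR_ge0// mulr_ge0// exprn_ge0//.
  exact: ltW.
have TE : series (fun j => amplitude alpha j * \sum_(i < n)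
    eval (pd i (pd i (profile n kappa N))) (rho j) (x - p j)) = - series T.
  rewrite -seriesN; congr series; apply/funext => j.
  by rewrite laplacian_profile// mulrN.
pose V := (2 + potential beta x) `^ mu.
have TV j : T j <= b j * V.
  apply: le_trans (bubble_dominated C0 (rho_gt0 j) _ Nbig (Cb j)) _.
    by rewrite lerDl sqnorm_ge0.
  apply: ler_wpM2l => //.
  have low : 0 <= rho j `^ beta * (rho j + sqnorm (x - p j)) `^ (- kappa).
    by rewrite mulr_ge0 ?powR_ge0.
  have up := potential_ge j x0 bb.
  apply: ge0_ler_powR; rewrite ?nnegrE ?(ltW mu0)//.
    by rewrite addr_ge0//; exact: le_trans up.
  by apply: le_trans up _; rewrite lerDr.
have cbV : cvgn (series (fun j => b j * V)).
  have -> : (fun j => b j * V) = V *: b by apply/funext => j; rewrite /GRing.scale /= mulrC.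
  exact: is_cvg_seriesZ.
have cT : cvgn (series T) by apply: (series_le_cvg T0 _ TV cbV) => j; exact: le_trans (TV j).
rewrite (@laplacian_superpose _ _ _ b) => //; last first.
  by move=> k; rewrite ger0_norm ?powR_ge0.
rewrite TE limN// opprK; apply/andP; split.
  by apply: le_trans (term_le_lim_series 0 T0 cT); exact: T0.
have bV : limn (series (fun j => b j * V)) = V.
  have -> : (fun j => b j * V) = V *: b by apply/funext => j; rewrite /GRing.scale /= mulrC.
  by rewrite lim_seriesZ// (cvg_lim _ b_sum)// [_ *: _]mulr1.
by rewrite -[leRHS]bV; apply: lim_series_le.
Qed.

End Bubbles.

(** * The solutions *)

Unset Implicit Arguments.

Theorem theorem3p4 (R : realType) (n : nat) (lambda sigma : R) (h : R -> R)
  (hn : (3 <= n)%N)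
  (lambda_gt0 : 0 < lambda) (sigma_gt0 : 0 < sigma)
  (lt_sigma : 2 / (n%:R - 2) + n%:R / (n%:R - 2) * (1 / lambda) < sigma)
  (le_sigma_lambda : sigma <= lambda)
  (h_gt0 : forall r : R, 0 < r < 1 -> 0 < h r)
  (h_cont : {within `]0, 1[, continuous h})
  (h_lim : h r @[r --> 0^'+] --> +oo) :
  exists u v : 'rV[R]_n -> R,
    [/\ smooth_on (~` [set 0]) u,
        smooth_on (~` [set 0]) v,
        forall x : 'rV[R]_n, x != 0 ->
          [/\ 0 <= - laplacian u x <= v x `^ lambda,
              0 <= - laplacian v x <= u x `^ sigma,
              1 < u x
            & 1 < v x],
        ~ (u =O_ ((0 : 'rV[R]_n)^') (fun x : 'rV[R]_n => h (enorm x)))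
      & ~ (v =O_ ((0 : 'rV[R]_n)^') (fun x : 'rV[R]_n => h (enorm x)))].
Proof.
pose kappa : R := n%:R / 2 - 1.
have dim_kappa : n%:R = 2 * kappa + 2 by rewrite /kappa; field.
have n3 : (3 : R) <= n%:R by rewrite ler_nat.
have kappa_gt0 : 0 < kappa by rewrite /kappa; lra.
have sigma_kappa : 1 / kappa + (kappa + 1) / kappa * (1 / lambda) < sigma.
  apply: le_lt_trans lt_sigma; rewrite dim_kappa le_eqVlt; apply/orP; left; apply/eqP.
  by field; rewrite !gt_eqF//; lra.
have [alpha [beta [/andP[al0 alk] /andP[be0 bek] gap_lambda gap_sigma]]] :=
  exists_exponents kappa_gt0 lambda_gt0 sigma_gt0 le_sigma_lambda sigma_kappa.
pose N := Num.bound (kappa * lambda).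
have N_lambda : kappa * lambda <= kappa + N%:R + 2.
  have kl0 : 0 <= kappa * lambda by rewrite mulr_ge0// ltW.
  by have := archi_boundP kl0; rewrite -/N; lra.
have N_sigma : kappa * sigma <= kappa + N%:R + 2.
  by apply: le_trans N_lambda; rewrite ler_pM2l.
(* b j = 2^(-j-1) serves both as distance of p j to 0 and as weight of the j-th
   bubble. *)
pose b := geometric (2^-1 : R) 2^-1.
have b_gt0 j : 0 < b j by rewrite /b /= mulr_gt0 ?exprn_gt0 ?invr_gt0.
have b_lt1 j : b j < 1.
  rewrite /b /= -exprS exprn_ilt1 ?invr_ge0// invf_lt1// ltr1n//.
have b_sum : series b @ \oo --> (1 : R).
  have half : `|2^-1 : R| < 1 by rewrite ger0_norm// invf_lt1// ltr1n.
  have := @cvg_geometric_series R 2^-1 _ half.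
  by have -> : 2^-1 * (1 - 2^-1)^-1 = 1 :> R by field.
pose i0 : 'I_n := Ordinal (leq_trans (isT : 0 < 3)%N hn).
pose p j : 'rV[R]_n := b j *: delta_mx 0 i0.
have sqp j : sqnorm (p j) = b j ^+ 2.
  rewrite /p -[_ *: _]addr0 sqnorm_line mxE mulr0 mul0r addr0.
  rewrite /sqnorm big1 ?add0r// => i _; by rewrite mxE expr0n.
have enorm_p j : enorm (p j) = b j.
  by rewrite /enorm -/(sqnorm (p j)) sqp sqrtr_sqr gtr0_norm.
have p_neq0 j : p j != 0.
  apply/eqP => pj0; have := enorm_p j; rewrite pj0 /enorm big1 => [|i _].
    by rewrite sqrtr0 => bj0; have := b_gt0 j; rewrite -bj0 ltxx.
  by rewrite mxE expr0n.
have p_le1 j : `|p j| <= 1.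
  rewrite -(@ler_pXn2r _ 2)// ?nnegrE// expr1n.
  apply: le_trans (sqnorm_ge_norm _) _; rewrite sqp -(expr1n _ 2).
  by rewrite ler_pXn2r ?nnegrE ?ltW.
have p_cvg0 : p j @[j --> \oo] --> (0 : 'rV[R]_n).
  rewrite -(scale0r (delta_mx 0 i0 : 'rV[R]_n)).
  apply: cvgZr_tmp; apply: cvg_geometric.
  by rewrite ger0_norm// invf_lt1// ltr1n.
have hp j : 0 < h (enorm (p j)) by rewrite enorm_p h_gt0// b_gt0 b_lt1.
pose C := 4 * coef kappa N * (kappa + N%:R) * (kappa + N%:R + 1).
have exp_lambda : 0 < alpha - kappa - 1 + (kappa - beta) * lambda by lra.
have exp_sigma : 0 < beta - kappa - 1 + (kappa - alpha) * sigma by lra.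
(* Every requirement on rho_j bounds a positive power of it, so all of them
   hold for small enough values. *)
have small (j : nat) : exists r : R, [/\ 0 < r <= 1,
    r `^ alpha <= b j /\ r `^ beta <= b j,
    C * r `^ (alpha - kappa - 1 + (kappa - beta) * lambda) <= b j,
    C * r `^ (beta - kappa - 1 + (kappa - alpha) * sigma) <= b j
  & j.+1%:R * h (enorm (p j)) <= r `^ (alpha - kappa) /\
    j.+1%:R * h (enorm (p j)) <= r `^ (beta - kappa)].
  have scaled (K r e : R) : K / b j * r `^ e <= 1 -> K * r `^ e <= b j.
    by rewrite mulrAC ler_pdivrMr// mul1r.
  have scaled1 (r e : R) : (b j)^-1 * r `^ e <= 1 -> r `^ e <= b j.
    by rewrite -{1}[_^-1]mul1r => /scaled; rewrite mul1r.
  have inverted (K r e g : R) : 0 < r -> K * r `^ (e - g) <= 1 -> K <= r `^ (g - e).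
    by move=> r0; rewrite -(opprB e) powRN -ler_pdivlMr ?powR_gt0// mul1r.
  near (0 : R)^'+ => r.
  have r0 : 0 < r by near: r; exact: nbhs_right_gt.
  exists r; split.
  - rewrite r0 /=; near: r; exact: nbhs_right_le.
  - by split; apply: scaled1; near: r; exact: near0_powR_le.
  - by apply: scaled; near: r; exact: near0_powR_le.
  - by apply: scaled; near: r; exact: near0_powR_le.
  - by split; apply: inverted => //; near: r; apply: near0_powR_le; rewrite subr_gt0.
have [rho rhoP] := choice small.
have rho01 j : 0 < rho j <= 1 by have [] := rhoP j.
have ab j : rho j `^ alpha <= b j by have [_ []] := rhoP j.
have bb j : rho j `^ beta <= b j by have [_ []] := rhoP j.
have cb : cvgn (series b) by exact: cvgP b_sum.
pose potential g := superpose (fun j => rho j `^ g) rho p (profile n kappa N).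
have pot_ge g j x : (forall k, rho k `^ g <= b k) -> x != 0 ->
    rho j `^ g * (rho j + sqnorm (x - p j)) `^ (- kappa) <= potential g x.
  by move=> gb x0; apply: (@potential_ge _ _ _ _ b).
have gt1 g x : (forall k, rho k `^ g <= b k) -> x != 0 -> 1 < 2 + potential g x.
  move=> gb x0; have : 0 <= potential g x.
    by apply: le_trans (pot_ge g 0 x gb x0); rewrite mulr_ge0 ?powR_ge0.
  by lra.
have norm_le g : (forall k, rho k `^ g <= b k) -> forall k, `|rho k `^ g| <= b k.
  by move=> gb k; rewrite ger0_norm ?powR_ge0.
have peak g : (forall k, rho k `^ g <= b k) ->
    (forall j, j.+1%:R * h (enorm (p j)) <= rho j `^ (g - kappa)) ->
    ~ ((fun x => 2 + potential g x) =O_ ((0 : 'rV[R]_n)^') (fun x : 'rV[R]_n => h (enorm x))).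
  move=> gb hg; apply: (not_bigO_of_peaks p_cvg0) => // j.
  apply: le_trans (hg j) _; apply: (@le_trans _ _ (potential g (p j))); last by rewrite lerDr.
  apply: le_trans (pot_ge g j (p j) gb (p_neq0 j)).
  rewrite subrr [sqnorm 0]big1 => [|i _]; last by rewrite mxE expr0n.
  rewrite addr0 powRD//.
  by have /andP[r0 _] := rho01 j; rewrite (gt_eqF r0) implybT.
exists (fun x => 2 + potential alpha x), (fun x => 2 + potential beta x); split.
- exact: (smooth_superpose rho01 p_le1 p_cvg0 (norm_le _ ab) cb).
- exact: (smooth_superpose rho01 p_le1 p_cvg0 (norm_le _ bb) cb).
- move=> x x0; split; [| |exact: gt1|exact: gt1].
  + apply: (laplacian_potential kappa_gt0 dim_kappa rho01 p_le1 p_cvg0 b_sum) => // j.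
    by have [] := rhoP j.
  + apply: (laplacian_potential kappa_gt0 dim_kappa rho01 p_le1 p_cvg0 b_sum) => // j.
    by have [] := rhoP j.
- by apply: peak => // j; have [_ _ _ _ []] := rhoP j.
- by apply: peak => // j; have [_ _ _ _ []] := rhoP j.
Unshelve. all: by end_near. Qed.
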